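(* Let $\mathbb{F}_2(t)$ be the rational function field over $\mathbb{F}_2$, where $t$ is transcendental over $\mathbb{F}_2$. Then the quadratic polynomial $f(x)=x^2+t\in\mathbb{F}_2(t)[x]$ is stable; that is, for every $n\ge 1$ the $n$-th iterate $f^{(n)}(x)$ is irreducible over $\mathbb{F}_2(t)$.
   Context: For a field $K$ and a polynomial $f(x)\in K[x]$, the iterates are defined by $f^{(1)}(x)=f(x)$ and $f^{(n+1)}(x)=f(f^{(n)}(x))$ for $n\ge 1$. The polynomial $f$ is called stable if all of its iterates $f^{(n)}(x)$, $n\ge 1$, are irreducible in $K[x]$. *)

(* Defs.v *)
From mathcomp Require Import all_boot all_order all_algebra.

Set Implicit Arguments.
Unset Strict Implicit.
Unset Printing Implicit Defensive.

Import GRing.Theory.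
Local Open Scope ring_scope.

(* poly_iter f n is the n-th iterate of f for n >= 1: poly_iter f 1 = f and
   poly_iter f n.+2 = f \Po poly_iter f n.+1, definitionally.  The value f at
   n = 0 is junk. *)
Definition poly_iter (K : fieldType) (f : {poly K}) (n : nat) : {poly K} :=
  iter n.-1 (fun g : {poly K} => f \Po g) f.

Definition stable_poly (K : fieldType) (f : {poly K}) : Prop :=
  forall n : nat, (0 < n)%N -> irreducible_poly (poly_iter f n).

Notation "'F2(t)'" := {fraction {poly 'F_2}} : type_scope.

(* The indeterminate of {poly 'F_2}, seen in the fraction field. *)
Definition ratfun_t : F2(t) := tofrac ('X : {poly 'F_2}).

(* Main.v *)
(** In characteristic [2] squaring is additive, so the [n]-th iterate is the
    binomial [X^N + c] with [N = 2^n] and [c = t + t^2 + ... + t^(2^(n-1))].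
    A monic factor of degree [m] of [X^N - c] has a companion matrix [A] with
    [A^N = c I]; taking determinants, [(det A)^N = c^m].  Since [c] has
    [t]-adic valuation [1], this forces [N] to divide [m]. *)
Require Import Defs.
From mathcomp Require Import all_boot all_order all_algebra.

Set Implicit Arguments.
Unset Strict Implicit.
Unset Printing Implicit Defensive.

Import GRing.Theory.
Local Open Scope ring_scope.

Lemma detX (R : comNzRingType) (n : nat) (A : 'M[R]_n.+1) (k : nat) :
  \det (A ^+ k) = \det A ^+ k.
Proof.
elim: k => [|k IHk]; first by rewrite !expr0 det1.
by rewrite !exprS -mulmxE det_mulmx IHk.
Qed.

Lemma monic_char_poly (R : comNzRingType) (n : nat) (q : {poly R}) :
  q \is monic -> size q = n.+1 -> exists A : 'M[R]_n, char_poly A = q.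
Proof.
move=> q_monic szq; have -> : n = (size q).-1 by rewrite szq.
by exists (companionmx q); exact: companionmxK.
Qed.

Lemma monic_dvd_binomial (K : fieldType) (N n : nat) (c : K) (q : {poly K}) :
  q \is monic -> size q = n.+2 -> q %| 'X^N - c%:P ->
  exists a : K, a ^+ N = c ^+ n.+1.
Proof.
move=> q_monic szq /dvdpP[h def_h].
have [A charA] := monic_char_poly q_monic szq.
(* Since [c ^+ n.+1] is the determinant of the scalar matrix [c%:M], it suffices that ['X^N - c%:P]
   vanishes at [A]; it is a multiple of [char_poly A], so Cayley-Hamilton applies. *)
exists (\det A); rewrite -detX -det_scalar; congr (\det _); apply/eqP.
rewrite -subr_eq0 -{1}(horner_mx_X A) -rmorphXn -(horner_mx_C A) -rmorphB /=.
by rewrite def_h -charA rmorphM /= Cayley_Hamilton mulr0.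
Qed.

(** A nonconstant divisor has degree [m] with [c ^+ m] an [N]-th power, hence [m] is a positive
    multiple of [N] and the divisor has full degree. *)
Lemma irreducible_binomial (K : fieldType) (N : nat) (c : K) :
  (0 < N)%N -> (forall (m : nat) (a : K), a ^+ N = c ^+ m -> (N %| m)%N) ->
  irreducible_poly ('X^N - c%:P).
Proof.
move=> N_gt0 powN; have szN := size_XnsubC c N_gt0.
split=> [|q szq1 q_dvd]; first by rewrite szN.
have XNc_neq0 : 'X^N - c%:P != 0 :> {poly K} by rewrite -size_poly_gt0 szN.
have q_neq0 := dvdpN0 q_dvd XNc_neq0.
have lq_neq0 : (lead_coef q)^-1 != 0 by rewrite invr_eq0 lead_coef_eq0.
case szq: (size q) szq1 => [|[|n]] // _.
  by move/eqP: szq; rewrite size_poly_eq0 (negPf q_neq0).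
rewrite -(dvdp_size_eqp q_dvd) szN eqn_leq -{1}szN dvdp_leq //= szq ltnS.
have [|||a /powN] := @monic_dvd_binomial K N n c ((lead_coef q)^-1 *: q).
- by rewrite monicE lead_coefZ mulVf // lead_coef_eq0.
- by rewrite size_scale.
- by rewrite dvdpZl.
exact: dvdn_leq.
Qed.

Lemma fraction_quotient (R : idomainType) (a : {fraction R}) :
  exists u v : R, v != 0 /\ a * tofrac v = tofrac u.
Proof.
elim/quotW: a => x; exists \n_x, \d_x; split; first exact: denom_ratioP.
rewrite !piE; apply/eqmodP; rewrite /= FracField.equivfE /FracField.mulf.
by rewrite !numden_Ratio ?mulf_neq0 ?oner_eq0 ?denom_ratioP // !mulr1 mulrC.
Qed.

Lemma mupX (F : fieldType) (x : F) (p : {poly F}) (n : nat) :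
  p != 0 -> mup x (p ^+ n) = (n * mup x p)%N.
Proof.
move=> p_neq0; elim: n => [|n IHn]; first by rewrite mupNroot // root1.
by rewrite exprS mupM ?expf_neq0 // IHn mulSn.
Qed.

(** The multiplicity at [x] serves as valuation: writing [a] as [u / v] gives
    [u ^+ N = p ^+ m * v ^+ N], so [m] is a difference of two multiples of [N]. *)
Lemma tofrac_powers (F : fieldType) (x : F) (p : {poly F}) (N m : nat)
    (a : {fraction {poly F}}) :
  (0 < N)%N -> mup x p = 1%N -> a ^+ N = tofrac p ^+ m -> (N %| m)%N.
Proof.
move=> N_gt0 mup_p aN; have [u [v [v_neq0 av]]] := fraction_quotient a.
(* As an ordinal below [(size p).+1], [mup x p] takes the default value 0 at [p = 0]. *)
have p_neq0 : p != 0.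
  apply: contra_eq_neq mup_p => ->; rewrite neq_ltn ltnS.
  by rewrite -[leqRHS](size_poly0 F) -ltnS ltn_ord.
have uv : u ^+ N = p ^+ m * v ^+ N.
  by apply/eqP; rewrite -tofrac_eq tofracM !tofracXn -aN -exprMn av.
have u_neq0 : u != 0.
  have: u ^+ N != 0 by rewrite uv mulf_neq0 ?expf_neq0.
  by rewrite expf_eq0 N_gt0.
have := congr1 (mup x) uv.
rewrite mupM ?expf_neq0 // !mupX // mup_p muln1 => eqN.
by rewrite -(dvdn_addl (n := N * mup x v)) ?dvdn_mulr // -eqN dvdn_mulr.
Qed.

Lemma poly_iter_X2addC (K : fieldType) (c : K) (n : nat) :
  2 \in [pchar K] ->
  poly_iter ('X^2 + c%:P) n.+1 =
    'X^(2 ^ n.+1) + (\sum_(i < n.+1) c ^+ (2 ^ i))%:P.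
Proof.
move=> char2; have charP : 2 \in [pchar {poly K}] by rewrite pchar_poly.
elim: n => [|n IHn]; first by rewrite big_ord1 expr1.
rewrite [LHS](_ : _ = ('X^2 + c%:P) \Po poly_iter ('X^2 + c%:P) n.+1) //.
rewrite IHn comp_polyD comp_polyC comp_Xn_poly.
rewrite -(pFrobenius_autE charP) rmorphD /= !pFrobenius_autE.
rewrite -exprM -expnSr -rmorphXn -addrA -rmorphD /=; congr (_ + _%:P).
(* Squaring the sum shifts its exponents from [2 ^ i] to [2 ^ i.+1]; the added [c] supplies the
   missing term at index 0. *)
rewrite -(pFrobenius_autE char2) rmorph_sum [RHS]big_ord_recl expr1 addrC.
by congr (_ + _); apply: eq_bigr => i _; rewrite /= pFrobenius_autE -exprM -expnSr.
Qed.

(** After one factor ['X] is pulled out, the cofactor takes the value 1 at 0, because the exponents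
    [(2 ^ i.+1).-1] are all positive. *)
Lemma mup_additive_trace (F : fieldType) (n : nat) :
  mup 0 (\sum_(i < n.+1) 'X ^+ (2 ^ i) : {poly F}) = 1%N.
Proof.
have -> : \sum_(i < n.+1) 'X ^+ (2 ^ i) =
    ('X - 0%:P) * (1 + \sum_(i < n) 'X ^+ (2 ^ i.+1).-1) :> {poly F}.
  rewrite subr0 mulrDr mulr1 mulr_sumr big_ord_recl expr1; congr (_ + _).
  by apply: eq_bigr => i _; rewrite -exprS prednK // expn_gt0.
rewrite mupMl; first by rewrite -[_ - _]expr1 mup_XsubCX eqxx.
rewrite /root hornerD hornerC horner_sum big1 ?addr0 ?oner_eq0 // => i _.
by rewrite hornerXn expr0n -leqn0 -ltnS prednK ?expn_gt0 // expnS leqNgt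
           -[2%N]muln1 leq_mul // expn_gt0.
Qed.

Theorem mainTheorem2 :
  stable_poly ('X^2 + ratfun_t%:P : {poly F2(t)}).
Proof.
have char2P : 2 \in [pchar {poly 'F_2}] by rewrite pchar_poly pchar_Fp.
have char2 : 2 \in [pchar F2(t)].
  exact: (rmorph_pchar (@tofrac _) char2P).
move=> [//|n] _; rewrite poly_iter_X2addC //.
set c := \sum_(i < _) _.
have -> : c = tofrac (\sum_(i < n.+1) 'X ^+ (2 ^ i)).
  by rewrite rmorph_sum; apply: eq_bigr => i _; rewrite rmorphXn.
(* Signs are immaterial in characteristic 2, which turns the iterate into the form ['X^N - c%:P]. *)
rewrite -[X in _ + X]oppr_pchar2 ?pchar_poly //.
apply: irreducible_binomial => [|m a]; first by rewrite expn_gt0.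
by apply: tofrac_powers (mup_additive_trace _ n); rewrite expn_gt0.
Qed.
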